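(* Let $\mathcal{H}$ be a complex separable Hilbert space, let $A,B\in\mathcal{L}(\mathcal{H})$ be selfadjoint operators, and suppose that $B$ is indefinite. Assume $I_\geq(A,B)=[\lambda_-,\lambda_+]$ with $\lambda_-,\lambda_+\in\mathbb{R}$, $\lambda_-\leq\lambda_+$. Then $I_>(A,B)\neq\varnothing$ if and only if there exists $\alpha>0$ such that $$\langle Ax,x\rangle\geq\alpha\|x\|^2\qquad\text{for every }x\in\mathcal{H}\text{ such that }\langle Bx,x\rangle=0.$$ In this case, $\lambda_-<\lambda_+$ and $I_>(A,B)=(\lambda_-,\lambda_+)$.
   Context: $\mathcal{L}(\mathcal{H})$ is the algebra of bounded linear operators on $\mathcal{H}$. An operator $C\in\mathcal{L}(\mathcal{H})$ is positive semidefinite if $\langle Cx,x\rangle\geq 0$ for all $x\in\mathcal{H}$, and positive definite if there exists $\beta>0$ such that $\langle Cx,x\rangle\geq\beta\|x\|^2$ for all $x\in\mathcal{H}$. A selfadjoint operator $B$ is indefinite if there exist $x_+,x_-\in\mathcal{H}$ with $\langle Bx_+,x_+\rangle>0$ and $\langle Bx_-,x_-\rangle<0$. For selfadjoint $A,B\in\mathcal{L}(\mathcal{H})$, $$I_\geq(A,B)=\{\rho\in\mathbb{R}: A+\rho B\text{ is positive semidefinite}\},\qquad I_>(A,B)=\{\rho\in\mathbb{R}: A+\rho B\text{ is positive definite}\}.$$ *)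

(* Defs.v *)
From HB Require Import structures.
From mathcomp Require Import all_boot all_order all_algebra.
From mathcomp Require Import complex.
From mathcomp Require Import all_classical all_reals all_analysis.

Set Implicit Arguments.
Unset Strict Implicit.
Unset Printing Implicit Defensive.

Import Order.TTheory GRing.Theory Num.Theory.
Import numFieldNormedType.Exports.

Local Open Scope classical_set_scope.
Local Open Scope complex_scope.
Local Open Scope ring_scope.

(* A complex Hilbert space is a complete normed module over R[i] together with
   an inner product (linear in its first argument) that induces the norm.
   Norms and inner products take values in R[i], whose partial order satisfies
   z <= w iff 'Im z = 'Im w and 'Re z <= 'Re w; in particular 0 <= z means that
   z is real and nonnegative. *)
Definition inner_product_norm (R : realType) (H : completeNormedModType R[i])
    (dot : {dot H for Num.conj}) : Prop :=
  forall x : H, `|x| ^+ 2 = dot x x.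

Definition separable_space (T : topologicalType) : Prop :=
  exists2 D : set T, countable D & dense D.

Section Operators.
Variables (R : realType) (H : completeNormedModType R[i]).
Variable dot : {dot H for Num.conj}.
Implicit Types A B C : {linear H -> H}.

Definition bounded_operator C : Prop :=
  exists M : R, forall x : H, `|C x| <= M%:C * `|x|.

Definition selfadjoint C : Prop :=
  forall x y : H, dot (C x) y = dot x (C y).

Definition positive_semidefinite C : Prop :=
  forall x : H, 0 <= dot (C x) x.

Definition positive_definite C : Prop :=
  exists2 beta : R, 0 < beta &
    forall x : H, beta%:C * `|x| ^+ 2 <= dot (C x) x.

Definition indefinite B : Prop :=
  (exists x : H, 0 < dot (B x) x) /\ (exists x : H, dot (B x) x < 0).

Definition I_ge A B : set R :=
  [set rho | positive_semidefinite (A \+ rho%:C \*: B)].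

Definition I_gt A B : set R :=
  [set rho | positive_definite (A \+ rho%:C \*: B)].

End Operators.

(* Main.v *)
Require Import Defs.
From HB Require Import structures.
From mathcomp Require Import all_boot all_order all_algebra.
From mathcomp Require Import complex.
From mathcomp Require Import all_classical all_reals all_analysis.
From mathcomp Require Import ring lra.

(** Write a(x) = <Ax, x> and b(x) = <Bx, x>; these are real numbers because A
    and B are selfadjoint, so the whole question is about real quadratic forms.

    If A + rho B >= beta > 0, then a(x) >= beta |x|^2 wherever b vanishes, which
    is the easy implication.  The converse is the Krein-Smul'jan lemma (the
    S-lemma with an equality constraint), [ge0_on_zeros_pencil], applied to
    c(x) = a(x) - alpha |x|^2: if c >= 0 on the zeros of the indefinite form b,
    then c + rho b >= 0 everywhere for some real rho, so A + rho B >= alpha.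
    Such a rho must satisfy - c(x) / b(x) <= rho <= - c(y) / b(y) whenever
    b(x) > 0 > b(y), and it exists as soon as each of these lower bounds lies
    below each of these upper bounds.  For given x and y, the real line
    s |-> s x + y meets the zeros of b at two points of opposite signs s; the
    inequality comes from combining c >= 0 at these two points
    ([quadratic_comb_ge0]).  Only real multiples of x are involved, hence no
    choice of phase.

    For the description of I_>, boundedness of B shows that a positive definite
    pencil stays positive semidefinite under a small change of rho
    ([I_gt_interior]), so I_> lies in the open interval.  In the other direction,
    a convex combination of a positive definite operator, with nonzero weight,
    and a positive semidefinite one is positive definite ([I_gt_convex]).  If
    I_> contains rho, every point of the open interval is such a combination of
    rho and one of the endpoints lm, lp. *)

Set Implicit Arguments.
Unset Strict Implicit.
Unset Printing Implicit Defensive.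

Import Order.TTheory GRing.Theory Num.Theory.
Import numFieldNormedType.Exports.

Local Open Scope classical_set_scope.
Local Open Scope complex_scope.
Local Open Scope ring_scope.

(** Quadratic behaviour is only asked along real lines: it is all that the
    argument needs, and it holds for [numform C] without a polarised form. *)
Definition quadratic (R : rcfType) (V : lmodType R[i]) (q : V -> R) : Prop :=
  forall x y : V, exists m : R, forall s : R,
    q (s%:C *: x + y) = s ^+ 2 * q x + s * m + q y.

(** By Vieta, the roots s1 > 0 > s2 of b2 s^2 + b1 s + b0 have product b0 / b2.
    In s1 P(s2) - s2 P(s1), where P(s) = c2 s^2 + c1 s + c0, the weights are
    positive and c1 cancels; what remains is (s1 - s2) (c0 - c2 b0 / b2). *)
Lemma quadratic_comb_ge0 (R : rcfType) (b2 b1 b0 c2 c1 c0 : R) :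
  0 < b2 -> b0 < 0 ->
  (forall s, s ^+ 2 * b2 + s * b1 + b0 = 0 ->
     0 <= s ^+ 2 * c2 + s * c1 + c0) ->
  0 <= b2 * c0 - b0 * c2.
Proof.
move=> b2_gt0 b0_lt0 c_ge0.
pose D := b1 ^+ 2 - 4 * b2 * b0; pose r := Num.sqrt D.
have D_gt0 : 0 < D by rewrite /D; nra.
have r_gt0 : 0 < r by rewrite sqrtr_gt0.
have r2 : r ^+ 2 = D by rewrite sqr_sqrtr // ltW.
have b2_neq0 : b2 != 0 by rewrite gt_eqF.
(* The roots are (t - b1) / (2 b2) with t = r or t = - r; denominators are
   cleared so that [ring] can treat the combination. *)
have root_ge0 t : t ^+ 2 = D ->
    0 <= c2 * (t - b1) ^+ 2 + 2 * b2 * c1 * (t - b1) + 4 * b2 ^+ 2 * c0.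
  move=> t2; have := c_ge0 ((t - b1) / (2 * b2)).
  have -> : ((t - b1) / (2 * b2)) ^+ 2 * b2 + (t - b1) / (2 * b2) * b1 + b0
      = (t ^+ 2 - D) / (4 * b2) by rewrite /D; field.
  rewrite t2 subrr mul0r => /(_ erefl) h.
  have -> : c2 * (t - b1) ^+ 2 + 2 * b2 * c1 * (t - b1) + 4 * b2 ^+ 2 * c0
    = 4 * b2 ^+ 2 * (((t - b1) / (2 * b2)) ^+ 2 * c2
                     + (t - b1) / (2 * b2) * c1 + c0) by field.
  by rewrite mulr_ge0 // mulr_ge0 // sqr_ge0.
have P := root_ge0 r r2.
have N := root_ge0 (- r) (etrans (sqrrN r) r2).
(* The roots have opposite signs because D - b1^2 = - 4 b2 b0 > 0. *)
have /andP[Nr_lt lt_r] : - r < b1 < r.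
  rewrite -ltr_norml -(ltr_pXn2r (n := 2)) ?nnegrE ?normr_ge0 ?ltW //.
  by rewrite real_normK ?num_real // r2 /D; nra.
have rb_gt0 : 0 < r + b1 by lra.
have br_gt0 : 0 < r - b1 by lra.
have := addr_ge0 (mulr_ge0 (ltW rb_gt0) P) (mulr_ge0 (ltW br_gt0) N).
have -> : (r + b1) * (c2 * (r - b1) ^+ 2 + 2 * b2 * c1 * (r - b1)
        + 4 * b2 ^+ 2 * c0)
    + (r - b1) * (c2 * (- r - b1) ^+ 2 + 2 * b2 * c1 * (- r - b1)
        + 4 * b2 ^+ 2 * c0)
  = 2 * r * (c2 * (r ^+ 2 - b1 ^+ 2) + 4 * b2 ^+ 2 * c0) by ring.
have -> : 2 * r * (c2 * (r ^+ 2 - b1 ^+ 2) + 4 * b2 ^+ 2 * c0)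
  = 8 * r * b2 * (b2 * c0 - b0 * c2) by rewrite r2 /D; ring.
by rewrite pmulr_rge0 // !mulr_gt0.
Qed.

(** The Krein-Smul'jan lemma.  The quotients - c / b over b > 0 are bounded
    above by those over b < 0, and any number between the two families works;
    rho is taken to be the supremum of the first family. *)
Lemma ge0_on_zeros_pencil (R : realType) (V : lmodType R[i]) (b c : V -> R) :
  quadratic b -> quadratic c ->
  (exists x, 0 < b x) -> (exists y, b y < 0) ->
  (forall x, b x = 0 -> 0 <= c x) ->
  exists rho : R, forall x, 0 <= c x + rho * b x.
Proof.
move=> qb qc [x0 bx0] [y0 by0] c_ge0.
have comb x y : 0 < b x -> b y < 0 -> 0 <= b x * c y - b y * c x.
  move=> bx by_; have [mb Eb] := qb x y; have [mc Ec] := qc x y.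
  apply: (quadratic_comb_ge0 (b1 := mb) (c1 := mc)) => // s.
  by rewrite -Eb -Ec => /c_ge0.
pose E := [set - c x / b x | x in [set x | 0 < b x]].
have ubE y : b y < 0 -> ubound E (- c y / b y).
  move=> by_ _ [x bx <-].
  rewrite ler_pdivrMr // mulrAC ler_ndivlMr //.
  have := comb x y bx by_; lra.
have supE : has_sup E.
  by split; [exists (- c x0 / b x0), x0 | exists (- c y0 / b y0); exact: ubE].
exists (sup E) => x; case: (ltrgtP (b x) 0) => bx.
- have : sup E <= - c x / b x by apply: ge_sup; [case: supE | exact: ubE].
  by rewrite ler_ndivlMr //; lra.
- have : - c x / b x <= sup E by apply: ub_le_sup; [case: supE | exists x].
  by rewrite ler_pdivrMr //; lra.
- by rewrite bx mulr0 addr0 c_ge0.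
Qed.

Section Forms.
Variables (R : realType) (H : completeNormedModType R[i]).
Variable dot : {dot H for Num.conj}.
Implicit Types A B C : {linear H -> H}.

Definition numform (f : H -> H) (x : H) : R := complex.Re (dot (f x) x).

Definition sqnorm (x : H) : R := numform id x.

Lemma quadratic_numform C : quadratic (numform C).
Proof.
move=> x y.
exists (complex.Re (dot (C x) y) + complex.Re (dot (C y) x)) => s.
rewrite /numform (linearP C) linearDl !linearDr ![in LHS]linearZl_LR /=.
rewrite ![in LHS]linearZr_LR /=.
have -> : Num.conj s%:C = s%:C :> R[i] by apply: conj_Creal; rewrite complex_real.
case: (dot (C x) x) => ? ?; case: (dot (C x) y) => ? ?.
case: (dot (C y) x) => ? ?; case: (dot (C y) y) => ? ? /=.
ring.
Qed.

(** Stated for a bare function so that it also applies to the identity, whose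
    form is the squared norm. *)
Lemma numformE (f : H -> H) x :
  (forall x y, dot (f x) y = dot x (f y)) -> dot (f x) x = (numform f x)%:C.
Proof.
move=> saf; rewrite RRe_real // CrealE; apply/eqP.
by rewrite [RHS]saf [RHS]hermC expr0 mul1r.
Qed.

Lemma sqnorm_ge0 x : 0 <= sqnorm x.
Proof. by have := dnorm_ge0 dot x; rewrite lecE => /andP[]. Qed.

Hypothesis hdot : inner_product_norm dot.

Lemma sqr_normE x : `|x| ^+ 2 = (sqnorm x)%:C.
Proof. by rewrite hdot (numformE (f := id)). Qed.

Lemma sqnorm_bounded C M x :
  (forall x, `|C x| <= M%:C * `|x|) -> sqnorm (C x) <= M ^+ 2 * sqnorm x.
Proof.
move=> /(_ x) CM; rewrite -lecR rmorphM rmorphXn /= -!sqr_normE -exprMn.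
by rewrite lerXn2r // nnegrE // (le_trans _ CM).
Qed.

(** Expanding |Cx + x|^2 >= 0 and |Cx - x|^2 >= 0 gives
    2 |<Cx, x>| <= |Cx|^2 + |x|^2, a form of Cauchy-Schwarz without square roots. *)
Lemma numform_bounded C : bounded_operator C ->
  exists2 K : R, 0 < K & forall x, `|numform C x| <= K * sqnorm x.
Proof.
case=> M CM; exists (M ^+ 2 + 1); first by rewrite ltr_wpDl ?sqr_ge0.
move=> x; have CxM := sqnorm_bounded x CM.
have x_ge0 := sqnorm_ge0 x; have Cx_ge0 := sqnorm_ge0 (C x).
have := dnorm_ge0 dot (C x + x); have := dnorm_ge0 dot (C x - x).
rewrite dnormB dnormD; move: CxM x_ge0 Cx_ge0; rewrite /sqnorm /numform.
have -> : Num.conj (dot (C x) x) = conjc (dot (C x) x) by [].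
case: (dot (C x) (C x)) => ? ?; case: (dot (C x) x) => ? ?.
case: (dot x x) => ? ?; rewrite !lecE /= => ? ? ? /andP[_ ?] /andP[_ ?].
rewrite ler_norml; lra.
Qed.

Lemma selfadjoint_pencil A B rho x :
  selfadjoint dot A -> selfadjoint dot B ->
  dot ((A \+ rho%:C \*: B) x) x = (numform A x + rho * numform B x)%:C.
Proof.
move=> saA saB; rewrite /= linearDl linearZl_LR /=.
by rewrite (numformE _ saA) (numformE _ saB) rmorphD rmorphM.
Qed.

Lemma I_gtP A B rho : selfadjoint dot A -> selfadjoint dot B ->
  I_gt dot A B rho <-> exists2 beta, 0 < beta &
    forall x, beta * sqnorm x <= numform A x + rho * numform B x.
Proof.
move=> saA saB; split=> -[beta beta_gt0 betaP]; exists beta => // x.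
- by rewrite -lecR -selfadjoint_pencil // rmorphM /= -sqr_normE; exact: betaP.
- by rewrite selfadjoint_pencil // sqr_normE -rmorphM lecR.
Qed.

Lemma I_geP A B rho : selfadjoint dot A -> selfadjoint dot B ->
  I_ge dot A B rho <-> forall x, 0 <= numform A x + rho * numform B x.
Proof.
move=> saA saB; split=> ABge0 x.
- by rewrite -lecR -selfadjoint_pencil //; exact: ABge0.
- by rewrite selfadjoint_pencil // lecR.
Qed.

(** If A + rho B >= beta and |<Bx, x>| <= K |x|^2, then the step beta / K
    changes the form by at most beta |x|^2. *)
Lemma I_gt_interior A B rho : bounded_operator B ->
  selfadjoint dot A -> selfadjoint dot B -> I_gt dot A B rho ->
  exists2 e, 0 < e & I_ge dot A B (rho - e) /\ I_ge dot A B (rho + e).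
Proof.
move=> bB saA saB /I_gtP[] // beta beta_gt0 betaP.
have [K K_gt0 KP] := numform_bounded bB.
have small x : `|beta / K * numform B x| <= beta * sqnorm x.
  rewrite normrM (gtr0_norm (divr_gt0 _ _)) // -mulrA ler_pM2l //.
  by rewrite ler_pdivrMl.
exists (beta / K); first exact: divr_gt0.
by split; apply/I_geP => // x; move: (betaP x) (small x); rewrite ler_norml; lra.
Qed.

Lemma I_gt_convex A B rho sigma t :
  selfadjoint dot A -> selfadjoint dot B ->
  I_gt dot A B rho -> I_ge dot A B sigma -> 0 < t <= 1 ->
  I_gt dot A B (t * rho + (1 - t) * sigma).
Proof.
move=> saA saB /I_gtP[] // beta beta_gt0 betaP /I_geP sigmaP /andP[t_gt0 t_le1].
apply/I_gtP => //; exists (t * beta); first exact: mulr_gt0.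
move=> x.
have t1_ge0 : 0 <= 1 - t by rewrite subr_ge0.
have := ler_wpM2l (ltW t_gt0) (betaP x).
have := mulr_ge0 t1_ge0 (sigmaP saA saB x); lra.
Qed.

(** The two alternatives are the two possible positions of [sigma]: tau lies
    between rho, which may be attained, and sigma, which may not, since the
    weight of rho must be nonzero. *)
Lemma I_gt_between A B rho sigma tau :
  selfadjoint dot A -> selfadjoint dot B ->
  I_gt dot A B rho -> I_ge dot A B sigma ->
  (rho <= tau < sigma) || (sigma < tau <= rho) -> I_gt dot A B tau.
Proof.
move=> saA saB gtA geA tauP.
have rs_neq0 : sigma - rho != 0 by rewrite subr_eq0; lra.
have -> : tau = (sigma - tau) / (sigma - rho) * rho
              + (1 - (sigma - tau) / (sigma - rho)) * sigma by field.
apply: I_gt_convex => //.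
case/orP: tauP => /andP[h1 h2].
- by rewrite divr_gt0 ?ler_pdivrMr ?mul1r; lra.
- by rewrite -divrNN divr_gt0 ?ler_pdivrMr ?mul1r; lra.
Qed.

(** The Krein-Smul'jan lemma applied to the form of A - alpha, and B. *)
Lemma I_gt_from_zeros A B alpha :
  selfadjoint dot A -> selfadjoint dot B -> indefinite dot B -> 0 < alpha ->
  (forall x, numform B x = 0 -> alpha * sqnorm x <= numform A x) ->
  I_gt dot A B !=set0.
Proof.
move=> saA saB [[xp xpP] [xm xmP]] alpha_gt0 alphaP.
have qC : quadratic (fun x => numform A x - alpha * sqnorm x).
  move=> x y; have [mA EA] := quadratic_numform A x y.
  have [m E] := quadratic_numform idfun x y.
  by exists (mA - alpha * m) => s; rewrite EA [sqnorm _]E /sqnorm; ring.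
have [||x /alphaP|rho rhoP] := ge0_on_zeros_pencil (quadratic_numform B) qC.
- by exists xp; rewrite -ltcR -numformE.
- by exists xm; rewrite -ltcR -numformE.
- by rewrite subr_ge0.
exists rho; apply/I_gtP => //; exists alpha => // x.
by have := rhoP x; lra.
Qed.

End Forms.

Theorem theorem3p8 (R : realType) (H : completeNormedModType R[i])
    (dot : {dot H for Num.conj})
    (hdot : inner_product_norm dot)
    (Hsep : separable_space H)
    (A B : {linear H -> H})
    (bA : bounded_operator A) (bB : bounded_operator B)
    (saA : selfadjoint dot A) (saB : selfadjoint dot B)
    (indB : indefinite dot B)
    (lm lp : R) (le_lm_lp : lm <= lp)
    (hI : I_ge dot A B = `[lm, lp]%classic) :
  (I_gt dot A B !=set0 <->
    exists2 alpha : R, 0 < alpha &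
      forall x : H, dot (B x) x = 0 ->
        alpha%:C * `|x| ^+ 2 <= dot (A x) x) /\
  (I_gt dot A B !=set0 -> lm < lp /\ I_gt dot A B = `]lm, lp[%classic).
Proof.
split.
  split=> [[rho /(I_gtP hdot)[] // alpha alpha_gt0 alphaP]|].
    exists alpha => // x; rewrite !numformE // => /complexI Bx0.
    by rewrite (sqr_normE hdot) -rmorphM lecR; have := alphaP x; rewrite Bx0; lra.
  move=> [alpha alpha_gt0 alphaP].
  apply: (I_gt_from_zeros hdot saA saB indB alpha_gt0) => x Bx0.
  have := alphaP x; rewrite !numformE // Bx0 => /(_ erefl).
  by rewrite (sqr_normE hdot) -rmorphM lecR.
have I_geE rho : I_ge dot A B rho <-> lm <= rho <= lp.
  by rewrite hI /= in_itv.
have sub rho : I_gt dot A B rho -> lm < rho < lp.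
  move=> /(I_gt_interior hdot bB saA saB)[e e_gt0 []].
  by move=> /I_geE + /I_geE; lra.
move=> [rho rhoP]; have rho_in := sub rho rhoP; split; first by lra.
apply/seteqP; split=> tau /=; rewrite in_itv /=; first exact: sub.
move=> tau_in; case: (leP rho tau) => rt.
- apply: (I_gt_between hdot saA saB rhoP (sigma := lp)); last lra.
  by apply/I_geE; lra.
- apply: (I_gt_between hdot saA saB rhoP (sigma := lm)); last lra.
  by apply/I_geE; lra.
Qed.
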